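(* Let $p$ be an odd prime such that $2$ is a semiprimitive root of $p$, i.e. $2$ has multiplicative order exactly $\frac{p-1}{2}$ modulo $p$ and the congruence $2^y\equiv -1 \pmod p$ has no integer solution $y$. Then for every natural number $x$, $$S_p(2^p x) = (-1)^{\frac{p-1}{2}}\, p\, S_p(2x).$$
   Context: For $m, x \in \mathbb{N}$, the Newman sum is $S_m(x)=\sum_{0\le n<x,\ n\equiv 0 \pmod m} (-1)^{\sigma(n)}$, where $\sigma(n)$ denotes the number of 1's in the binary expansion of $n$. *)

(* Defs.v *)
From mathcomp Require Import all_boot all_order all_algebra.
Set Implicit Arguments.
Unset Strict Implicit.
Unset Printing Implicit Defensive.
Import GRing.Theory.
Local Open Scope ring_scope.

(* The summand is the binary digit of weight 2 ^ i of n; since n < 2 ^ n, all  *)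
(* digits of index i >= n vanish, so the sum runs over the full expansion.     *)
Definition sigma (n : nat) : nat := (\sum_(i < n) odd (n %/ 2 ^ i))%N.

Definition newman_sum (m x : nat) : int :=
  \sum_(0 <= n < x | (m %| n)%N) (-1) ^+ sigma n.

(* Meaningful for p prime: 'F_p is then the field of residues modulo p.        *)
(* The exponent y ranges over all integers, so _ ^ y is the int power exprz.   *)
Definition semiprimitive_root (a p : nat) : Prop :=
  (p.-1)./2.-primitive_root (a%:R : 'F_p) /\
  ~ (exists y : int, (a%:R : 'F_p) ^ y = -1).

(* Main.v *)
Require Import Defs.
From mathcomp Require Import all_boot all_order all_algebra.
From mathcomp Require Import algC cyclotomic.
From mathcomp Require Import zify ring.
Set Implicit Arguments.
Unset Strict Implicit.
Unset Printing Implicit Defensive.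
Import Order.TTheory GRing.Theory Num.Theory.
Local Open Scope ring_scope.

(** Write [G z N] for the sum of [(-1) ^ sigma n * z ^ n] over [n < N].
    Splitting [n] by its last bit gives [G z (2 N) = (1 - z) G (z ^ 2) N], hence
    [G z (2 ^ p x) = (\prod_(i < p) (1 - z ^ 2 ^ i)) G (z ^ 2 ^ p) x].
    If [z] is a nontrivial [p]-th root of unity and [h = (p - 1) / 2], this
    product is [P ^ 2 (1 - z)], with [P] the product over [i < h].  The residues
    [2 ^ i] and [- 2 ^ i], [i < h], exhaust the units mod [p], so
    [P * P^* = p], where [P^*] is [P] at [z^-1]; and [P^* = (-1) ^ h P] because
    the [z ^ 2 ^ i] multiply to [z ^ (2 ^ h - 1) = 1].  Thus
    [G z (2 ^ p x) = (-1) ^ h p G z (2 x)] for all [p]-th roots of unity [z]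
    (both sides vanish at [z = 1]), and averaging over [z] gives the theorem. *)

Lemma sigma_widen n m : (n <= m)%N ->
  (\sum_(i < m) odd (n %/ 2 ^ i))%N = sigma n.
Proof.
move=> le_nm; rewrite /sigma.
rewrite -!(big_mkord xpredT (fun i => odd (n %/ 2 ^ i) : nat)).
rewrite (big_cat_nat _ le_nm) //= [X in (_ + X)%N]big1_seq ?addn0 //.
move=> i /andP[_]; rewrite mem_index_iota => /andP[le_ni _].
rewrite divn_small //; apply: leq_trans (ltn_expl n (isT : 1 < 2)%N) _.
by rewrite leq_exp2l.
Qed.

Lemma sigma_bit (b : bool) n : sigma (b + n.*2) = (b + sigma n)%N.
Proof.
(* One extra index lets digit 0 be split off even when [b + n.*2] is 0. *)
rewrite -(sigma_widen (leqnSn (b + n.*2))) big_ord_recl expn0 divn1 oddD.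
rewrite odd_double addbF oddb; congr (_ + _)%N.
rewrite -(@sigma_widen n (b + n.*2)); last by lia.
apply: eq_bigr => i _; rewrite /bump /= expnS divnMA divn2.
by rewrite half_bit_double.
Qed.

Definition newman_series (R : comNzRingType) (z : R) N : R :=
  \sum_(0 <= n < N) (-1) ^+ sigma n * z ^+ n.

Lemma newman_series_double (R : comNzRingType) (z : R) N :
  newman_series z (2 * N) = (1 - z) * newman_series (z ^+ 2) N.
Proof.
rewrite /newman_series mul2n; elim: N => [|N IHN].
  by rewrite !big_geq // mulr0.
rewrite doubleS !big_nat_recr //= IHN mulrDr -addrA; congr (_ + _).
have /= -> := sigma_bit false N; have /= -> := sigma_bit true N.
by rewrite add0n add1n -exprM mul2n !exprS; ring.
Qed.

Lemma newman_series_pow2 (R : comNzRingType) (z : R) k N :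
  newman_series z (2 ^ k * N) =
    (\prod_(i < k) (1 - z ^+ (2 ^ i))) * newman_series (z ^+ (2 ^ k)) N.
Proof.
elim: k N => [|k IHk] N; first by rewrite big_ord0 mul1r mul1n expr1.
rewrite expnSr -mulnA IHk newman_series_double big_ord_recr /= mulrA.
by rewrite -exprM.
Qed.

Lemma newman_series1 (R : comNzRingType) N :
  newman_series (1 : R) (2 * N) = 0.
Proof. by rewrite newman_series_double subrr mul0r. Qed.

(** The exponents obey 1 + (1 + 2 + ... + 2^(k-1)) = 2^k; the extra factor [z] avoids the
    subtraction in 2^k - 1. *)
Lemma prod_expr_pow2 (R : comNzRingType) (z : R) k :
  z * \prod_(i < k) z ^+ (2 ^ i) = z ^+ (2 ^ k).
Proof.
elim: k => [|k IHk]; first by rewrite big_ord0 mulr1 expr1.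
by rewrite big_ord_recr /= mulrA IHk -exprD addnn -mul2n expnS.
Qed.

Lemma prime_primitive_root (F : fieldType) p (z : F) :
  prime p -> z ^+ p = 1 -> z != 1 -> p.-primitive_root z.
Proof.
move=> p_pr zp z1; have [m prim_z] := prim_order_exists (prime_gt0 p_pr) zp.
case/primeP: p_pr => _ /[apply] /orP[] /eqP def_m; last by rewrite -def_m.
by move: (prim_expr_order prim_z) z1; rewrite def_m expr1 => ->; rewrite eqxx.
Qed.

(** Divide X^n - 1 = prod_i (X - z^i) by X - 1 and evaluate the quotient 1 + X + ... + X^(n-1) at
    1. *)
Lemma prod_1_sub_prim_root (F : fieldType) n (z : F) : n.-primitive_root z ->
  \prod_(1 <= i < n) (1 - z ^+ i) = n%:R.
Proof.
move=> prim_z; have n_gt0 := prim_order_gt0 prim_z.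
have := factor_Xn_sub_1 prim_z; rewrite big_ltn // expr0 subrX1.
move=> /(mulfI (negbT (polyXsubC_eq0 1))) /(congr1 (horner^~ 1)).
rewrite horner_prod horner_sum.
under eq_bigr do rewrite hornerXsubC.
move=> ->; under eq_bigr do rewrite hornerXn expr1n.
by rewrite sumr_const card_ord.
Qed.

(** This is a geometric sum of ratio z^m, which is 1 exactly when n divides m; otherwise z^(mn) = 1
    makes the sum vanish. *)
Lemma sum_prim_root_expr (F : fieldType) n (z : F) m : n.-primitive_root z ->
  \sum_(k < n) (z ^+ k) ^+ m = if (n %| m)%N then n%:R else 0.
Proof.
move=> prim_z; under eq_bigr do rewrite exprAC.
have [/dvdnP[q ->] | n_dvd] := ifPn.
  under eq_bigr do rewrite mulnC exprM (prim_expr_order prim_z) !expr1n.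
  by rewrite sumr_const card_ord.
have zm1 : z ^+ m - 1 != 0 by rewrite subr_eq0 -(prim_order_dvd prim_z).
apply: (mulfI zm1); rewrite -subrX1 exprAC (prim_expr_order prim_z) expr1n.
by rewrite subrr mulr0.
Qed.

Lemma prod_Fp_neq0 (R : comNzRingType) p (f : nat -> R) : prime p ->
  \prod_(u : 'F_p | u != 0) f u = \prod_(1 <= i < p) f i.
Proof.
move=> p_pr; transitivity (\prod_(0 <= i < p | i != 0%N) f i).
  by rewrite -[X in index_iota 0 X](Fp_cast p_pr) big_mkord.
rewrite big_ltn_cond ?prime_gt0 //= [LHS]big_nat_cond [RHS]big_nat_cond.
by apply: eq_bigl => i; rewrite andbT -lt0n; lia.
Qed.

(** With h = (p - 1) / 2, no power of [a] is the opposite of another: - a^j = a^i would give a^(i -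
    j) = -1, where i - j may be negative. So the two families are disjoint, and their 2h = p - 1
    members exhaust the units by counting. *)
Lemma prod_units_Fp (R : comNzRingType) p (a : 'F_p) (f : 'F_p -> R) :
    prime p -> odd p -> (p.-1)./2.-primitive_root a ->
    ~ (exists y : int, a ^ y = -1) ->
  \prod_(u | u != 0) f u =
    (\prod_(i < (p.-1)./2) f (a ^+ i)) * \prod_(i < (p.-1)./2) f (- a ^+ i).
Proof.
move=> p_pr p_odd; set h := _./2 => prim_a aN1.
have a_neq0 : a != 0.
  apply/eqP => a0; move: (prim_expr_order prim_a) (prim_order_gt0 prim_a).
  by rewrite a0 expr0n; case: (h) => //= _ /esym/eqP; rewrite oner_eq0.
have a_inj : {in iota 0 h &, injective (fun i => a ^+ i)}.
  move=> i j; rewrite !mem_iota /= !add0n => ltih ltjh /eqP.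
  by rewrite (eq_prim_root_expr prim_a) !modn_small // => /eqP.
pose s := [seq a ^+ i | i <- iota 0 h] ++ [seq - a ^+ i | i <- iota 0 h].
have s_uniq : uniq s.
  rewrite cat_uniq map_inj_in_uniq ?iota_uniq //= map_inj_in_uniq ?iota_uniq.
    rewrite andbT; apply/hasPn => _ /mapP[j _ ->]; apply/mapP => -[i _ eq_ij].
    apply: aN1; exists (i%:Z - j%:Z); rewrite expfzDr // -exprnP -invr_expz.
    by rewrite -exprnP -eq_ij mulNr divff // expf_neq0.
  by move=> i j Hi Hj /oppr_inj; apply: a_inj.
have s_sub : {subset s <= enum (predC1 (0 : 'F_p))}.
  move=> u; rewrite mem_enum mem_cat inE /= => /orP[] /mapP[i _ ->].
    exact: expf_neq0.
  by rewrite oppr_eq0 expf_neq0.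
have s_size : (size (enum (predC1 (0%R : 'F_p))) <= size s)%N.
  rewrite -cardE size_cat !size_map !size_iota cardC1 card_Fp //.
  by rewrite addnn /h; lia.
have [_ s_enum] := uniq_min_size s_uniq s_sub s_size.
have s_perm := uniq_perm s_uniq (enum_uniq _) s_enum.
rewrite -big_filter -[filter _ _]/(enum (predC1 0)) -(perm_big _ s_perm).
rewrite big_cat !big_map -(big_mkord xpredT (fun i => f (a ^+ i))).
by rewrite -(big_mkord xpredT (fun i => f (- a ^+ i))) /index_iota !subn0.
Qed.

(** Exponents are the representatives below p, and reduction mod p is harmless since z^p = 1. *)
Lemma expr_FpD (R : comNzRingType) p (z : R) (u v : 'F_p) :
  prime p -> z ^+ p = 1 -> z ^+ (u + v : 'F_p)%R = z ^+ u * z ^+ v.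
Proof.
move=> p_pr zp; rewrite -{1}[u]natr_Zp -{1}[v]natr_Zp -natrD val_Fp_nat //.
by rewrite expr_mod // exprD.
Qed.

Lemma prod_semiprimitive (F : fieldType) p (z : F) :
    prime p -> odd p -> semiprimitive_root 2 p -> p.-primitive_root z ->
  \prod_(i < p) (1 - z ^+ (2 ^ i)) = (-1) ^+ (p.-1)./2 * p%:R * (1 - z).
Proof.
move=> p_pr p_odd [prim_2 no_N1] prim_z; set h := _./2 in prim_2 *.
have zp := prim_expr_order prim_z.
have z_neq0 : z != 0.
  apply/eqP => z0; move/eqP: zp.
  by rewrite z0 expr0n eqn0Ngt prime_gt0 // eq_sym oner_eq0.
have z2E i : z ^+ (2%:R ^+ i : 'F_p)%R = z ^+ (2 ^ i).
  by rewrite -natrX val_Fp_nat // expr_mod.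
have zNE i : z ^+ (- 2%:R ^+ i : 'F_p)%R = (z ^+ (2 ^ i))^-1.
  apply: (mulIf (expf_neq0 (2 ^ i) z_neq0)); rewrite mulVf ?expf_neq0 //.
  by rewrite -z2E -expr_FpD // addNr expr0.
(* As 2^h = 1 in ['F_p], the factors of the product over i < p recur with period h. *)
have zDh i : z ^+ (2 ^ (h + i)) = z ^+ (2 ^ i).
  by rewrite -!z2E exprD (prim_expr_order prim_2) mul1r.
pose P := \prod_(i < h) (1 - z ^+ (2 ^ i)).
have PPconj : P * \prod_(i < h) (1 - (z ^+ (2 ^ i))^-1) = p%:R.
  rewrite -(prod_1_sub_prim_root prim_z).
  have := prod_units_Fp (fun u : 'F_p => 1 - z ^+ u) p_pr p_odd prim_2 no_N1.
  under [X in _ = X * _]eq_bigr do rewrite z2E.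
  under [X in _ = _ * X]eq_bigr do rewrite zNE.
  by move=> <-; rewrite (prod_Fp_neq0 (fun i => 1 - z ^+ i)).
have prod_z1 : \prod_(i < h) z ^+ (2 ^ i) = 1.
  apply: (mulfI z_neq0); rewrite prod_expr_pow2 mulr1.
  by have := zDh 0; rewrite addn0.
(* Multiply by the product of the w = z^(2^i), which is 1, and use w (1 - w^-1) = - (1 - w) in each
   factor. *)
have Pconj : \prod_(i < h) (1 - (z ^+ (2 ^ i))^-1) = (-1) ^+ h * P.
  rewrite -[LHS]mul1r -{1}prod_z1 -[h in (-1) ^+ h]card_ord -prodr_const.
  rewrite -!big_split; apply: eq_bigr => i _ /=.
  by rewrite mulN1r mulrBr mulr1 divff ?expf_neq0 // opprB.
have PP : P * P = (-1) ^+ h * p%:R.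
  rewrite -PPconj Pconj [P * (_ * _)]mulrCA [RHS]mulrA -exprMn mulrNN mulr1.
  by rewrite expr1n mul1r.
(* The range i < 2h + 1 yields two copies of [P] and a last factor, at i = 2h, equal to 1 - z by
   periodicity. *)
have def_p : p = (h + h).+1 by rewrite /h; lia.
rewrite -(big_mkord xpredT (fun i => 1 - z ^+ (2 ^ i))).
rewrite [X in index_iota 0 X]def_p big_mkord big_ord_recr big_split_ord /= -/P.
under [X in _ * X * _]eq_bigr do rewrite zDh.
by rewrite -/P PP zDh -[X in (2 ^ X)%N]addn0 zDh.
Qed.

Lemma newman_series_unity_root (F : fieldType) p (z : F) x :
    prime p -> odd p -> semiprimitive_root 2 p -> z ^+ p = 1 ->
  newman_series z (2 ^ p * x) =
    (-1) ^+ (p.-1)./2 * p%:R * newman_series z (2 * x).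
Proof.
move=> p_pr p_odd p_semi zp; have [-> | z1] := eqVneq z 1.
  rewrite -[p in (2 ^ p)%N](prednK (prime_gt0 p_pr)) expnS -mulnA.
  by rewrite !newman_series1 mulr0.
have prim_z := prime_primitive_root p_pr zp z1.
rewrite newman_series_pow2 prod_semiprimitive // newman_series_double mulrA.
(* By Fermat 2^p = 2 mod p, so z^(2^p) = z^2 and both sides involve the same series. *)
by rewrite -(expr_mod (2 ^ p) zp) fermat_little // expr_mod.
Qed.

(** Root-of-unity filter: after exchanging the sums, the sum over k of z^(kn) is p if p divides n
    and 0 otherwise. *)
Lemma newman_sumE p x (z : algC) : p.-primitive_root z ->
  p%:R * (newman_sum p x)%:~R = \sum_(k < p) newman_series (z ^+ k) x.
Proof.
move=> prim_z; rewrite exchange_big /= /newman_sum rmorph_sum.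
rewrite big_mkcond mulr_sumr; apply: eq_bigr => n _; rewrite -mulr_sumr.
rewrite (sum_prim_root_expr _ prim_z); case: ifP => _; last by rewrite !mulr0.
by rewrite rmorphXn rmorphN1 mulrC.
Qed.

Theorem theorem2 (p : nat) (p_prime : prime p) (p_odd : odd p)
    (p_semi : semiprimitive_root 2 p) (x : nat) :
  newman_sum p (2 ^ p * x)%N =
    (-1) ^+ (p.-1)./2 * p%:R * newman_sum p (2 * x)%N.
Proof.
have [z prim_z] := C_prim_root_exists (prime_gt0 p_prime).
have p_neq0 : p%:R != 0 :> algC by rewrite pnatr_eq0 -lt0n prime_gt0.
(* Embedding the integers in [algC] and multiplying by p reduces the claim to one identity for each
   root z^k. *)
apply: (@intr_inj algC); apply: (mulfI p_neq0).
rewrite !rmorphM rmorphXn rmorphN1 rmorph_nat mulrCA !(newman_sumE _ prim_z).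
rewrite mulr_sumr; apply: eq_bigr => k _; apply: newman_series_unity_root => //.
by rewrite exprAC (prim_expr_order prim_z) expr1n.
Qed.
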